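(* Let $p$ be a prime and $r$ a positive integer with $p^r\ge 3$. Let $\alpha$ be a generator of $\mathbb{F}_{p^{2r}}^*$, and let $C=\{C_0,\dots,C_{p^r}\}$, where $C_i=\{\alpha^t : t\equiv i \pmod{p^r+1}\}$, which is a $(p^{2r},p^r-1,p^r-2)$ disjoint difference family in the additive group of $\mathbb{F}_{p^{2r}}$. The $2$-$(p^{2r},p^r-1,p^r-2)$ design $dev(C)$ has exactly the following block intersection numbers with the following multiplicities (where, if two of the listed numbers coincide, the multiplicity of that number is the sum of the listed multiplicities): \[ \begin{array}{ll} \text{block intersection number} & \text{multiplicity}\\ 0 & \frac{1}{2}\left(3 p^{5r} + p^{4r} - 2 p^{3r}\right)\\ 1 & \frac{1}{2}\left(p^{6r} - p^{5r} - p^{4r} + p^{3r}\right)\\ p^r-2 & \frac{1}{2}\left(p^{4r}-p^{2r}\right) \end{array} \]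
   Context: The development of $C$ is the collection $dev(C)=\{C_i+g : 0\le i\le p^r,\ g\in\mathbb{F}_{p^{2r}}\}$ of all translates; its members are the blocks of the design with point set $\mathbb{F}_{p^{2r}}$. An integer $N$ is a block intersection number of a design if the design contains two distinct blocks $B,B'$ with $|B\cap B'|=N$; the multiplicity of $N$ is the number of unordered pairs of distinct blocks meeting in exactly $N$ points. *)

(* Defs.v *)
From mathcomp Require Import all_boot all_order all_algebra all_fingroup all_solvable.
From mathcomp Require Import boolp.

Set Implicit Arguments.
Unset Strict Implicit.
Unset Printing Implicit Defensive.

Import GRing.Theory.
Local Open Scope ring_scope.

Section DifferenceFamily.
Variables (G : finZmodType) (I : finType).
Implicit Type D : I -> {set G}.

(* The multiset of differences is counted by triples (i, x, y) with x, y in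
   the i-th member. *)
Definition disjoint_difference_family D (v k l : nat) : Prop :=
  [/\ #|G| = v,
      (forall i, #|D i| = k),
      (forall i j, i != j -> [disjoint D i & D j])
    & forall d : G, d != 0 ->
        #|[set t : I * G * G |
             [&& t.1.2 \in D t.1.1, t.2 \in D t.1.1 & t.1.2 - t.2 == d]]| = l].

Definition dev D : {set {set G}} :=
  [set [set x + g | x in D i] | i : I, g : G].

End DifferenceFamily.

Section Design.
Variable T : finType.
Implicit Type B : {set {set T}}.

Definition two_design B (v k l : nat) : Prop :=
  [/\ #|T| = v,
      (forall X, X \in B -> #|X| = k)
    & forall x y : T, x != y ->
        #|[set X in B | (x \in X) && (y \in X)]| = l].

Definition block_intersection_number B (N : nat) : Prop :=
  exists X Y : {set T}, [/\ X \in B, Y \in B, X != Y & #|X :&: Y| = N].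

(* Unordered pairs of distinct blocks are two-element sets of blocks. *)
Definition multiplicity B (N : nat) : nat :=
  #|[set [set X; Y] | X in B, Y in B & (X != Y) && (#|X :&: Y| == N)]|.

(* If a number is listed more than once in s, its multiplicity is the sum of
   the multiplicities listed with it. *)
Definition has_intersection_table B (s : seq (nat * rat)) : Prop :=
  (forall N, block_intersection_number B N <-> N \in [seq e.1 | e <- s]) /\
  (forall N, (multiplicity B N)%:R = \sum_(e <- s | e.1 == N) e.2).

End Design.

Definition cyclotomic_class (F : finFieldType) (a : {unit F}) (m i : nat) :
    {set F} :=
  [set x : F | `[< exists2 t : int, (t = i %[mod m])%Z & x = val a ^ t >]].

(* Main.v *)
Require Import Defs.
From mathcomp Require Import all_boot all_order all_algebra all_fingroup all_solvable.
From mathcomp Require Import all_field boolp ring zify.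

Set Implicit Arguments.
Unset Strict Implicit.
Unset Printing Implicit Defensive.

Import GRing.Theory.
Local Open Scope ring_scope.

(** Write q for p ^ r. The subgroup generated by alpha ^ (q + 1) is the
    multiplicative group of the subfield K of order q, so C_i is the K-line
    through alpha ^ i with the origin removed, and the q + 1 such lines cover
    the plane F over K. Only the additive structure matters from then on: the
    lines form a spread, i.e. q + 1 subgroups of order q, of a group of order
    q ^ 2, that meet pairwise in 0 and cover the group ([cyclotomic_spread]).

    For any spread L the blocks are the translates of the members of L with one
    point removed: block (i, g) is the affine line g + L i without the point g.
    How many points (i, g) and (j, h) share depends only on i, j and g - h:
    - if i = j and g - h is in L i, both lie on the same line and miss different
      points of it, so they share q - 2 points;
    - if i = j and g - h is not in L i, the lines are parallel and distinct;
    - if i and j differ, the lines cross in one point, which is g when g - h is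
      in L j and h when g - h is in L i; so the blocks share one point unless
      g - h is in the union of L i and L j, a set of size 2 q - 1.
    See [card_meet_same] and [card_meet_diff]. Since q >= 3, distinct pairs
    (i, g) give distinct blocks ([translate_punctured_inj]), and summing over
    all pairs of indices counts each unordered pair of blocks twice
    ([multiplicity_spread]). This single count covers every N, hence also q = 3,
    where the intersection numbers 1 and q - 2 coincide.

    The difference property holds because x - y = d with x and y in the same
    member of the spread forces that member to be the one containing d. *)

(** * Unordered pairs and intersection numbers *)

(** Each two-element set {x, y} comes from exactly the two ordered pairs (x, y)
    and (y, x), which differ because R is irreflexive. *)
Lemma card_unordered_pairs (T : finType) (A : {set T}) (R : rel T) :
  symmetric R -> irreflexive R ->
  #|[set u : T * T | [&& u.1 \in A, u.2 \in A & R u.1 u.2]]|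
    = (#|[set [set x; y] | x in A, y in A & R x y]|).*2.
Proof.
move=> symR irrR; set S := [set u : T * T | _]; set E := imset2 _ _ _.
pose f (u : T * T) := [set u.1; u.2].
have EE : E = f @: S.
  apply/setP=> P; apply/imset2P/imsetP.
    move=> [x y xA]; rewrite inE => /andP[yA Rxy] ->.
    by exists (x, y); rewrite // inE /= xA yA.
  move=> [[x y]]; rewrite inE /= => /and3P[xA yA Rxy ->].
  by exists x y; rewrite // inE yA.
rewrite -sum1_card (partition_big_imset f) -EE /= -muln2 -sum_nat_const.
apply: eq_bigr => P; rewrite EE => /imsetP[[x y] xyS ->].
have /and3P[xA yA Rxy] : [&& x \in A, y \in A & R x y].
  by move: xyS; rewrite inE.
have neq_xy : x != y by apply: contraTneq Rxy => ->; rewrite irrR.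
rewrite sum1_card -[RHS](_ : #|[set (x, y); (y, x)]| = 2%N); last first.
  by rewrite cards2 xpair_eqE negb_and neq_xy.
apply: eq_card => -[a b]; rewrite unfold_in !inE /= !xpair_eqE /f /=.
apply/idP/idP.
  case/andP=> /and3P[aA bA Rab] /eqP eqP2.
  have : a \in [set x; y] by rewrite -eqP2 !inE eqxx.
  have : b \in [set x; y] by rewrite -eqP2 !inE eqxx orbT.
  have neq_ab : a != b by apply: contraTneq Rab => ->; rewrite irrR.
  rewrite !inE => /orP[]/eqP eb /orP[]/eqP ea; subst a b;
    rewrite ?eqxx ?orbT //.
    by rewrite eqxx in neq_ab.
  by rewrite eqxx in neq_ab.
case/orP=> /andP[/eqP-> /eqP->]; first by rewrite xA yA Rxy eqxx.
by rewrite xA yA symR Rxy setUC eqxx.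
Qed.

Lemma block_intersection_number_gt0 (T : finType) (B : {set {set T}}) N :
  block_intersection_number B N <-> (0 < multiplicity B N)%N.
Proof.
rewrite card_gt0; split.
  move=> [X [Y [XB YB neqXY /eqP NXY]]]; apply/set0Pn; exists [set X; Y].
  by apply/imset2P; exists X Y; rewrite // inE YB neqXY.
case/set0Pn=> P /imset2P[X Y XB]; rewrite inE => /and3P[YB neqXY /eqP NXY] _.
by exists X, Y.
Qed.

(** * Developments *)

Section Translates.
Variables (G : finZmodType) (I : finType) (D : I -> {set G}).

Definition translate (u : I * G) : {set G} := [set x + u.2 | x in D u.1].

Lemma in_translate u x : (x \in translate u) = (x - u.2 \in D u.1).
Proof.
apply/imsetP/idP => [[y yD ->]|xD]; first by rewrite addrK.
by exists (x - u.2); rewrite // subrK.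
Qed.

Lemma dev_translate : dev D = translate @: setT.
Proof.
apply/setP=> X; apply/imset2P/imsetP => [[i g _ _ ->]|[[i g] _ ->]].
  by exists (i, g).
by exists i g.
Qed.

(** A block translate (i, g) through x and y is the same as a way of writing
    x - y as a difference within D i, namely (x - g) - (y - g). *)
Lemma ddf_two_design v k l : injective translate ->
  disjoint_difference_family D v k l -> two_design (dev D) v k l.
Proof.
move=> inj_tr [cardG cardD _ diffD]; split=> // [X|x y neq_xy].
  rewrite dev_translate => /imsetP[[i g] _ ->].
  by rewrite card_imset ?cardD //; apply: addIr.
have d0 : x - y != 0 by rewrite subr_eq0.
rewrite -(diffD _ d0) dev_translate.
pose S := [set u | (x \in translate u) && (y \in translate u)].
have -> : [set X in translate @: setT | (x \in X) && (y \in X)]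
  = translate @: S.
  apply/setP=> X; rewrite inE; apply/andP/imsetP.
    by move=> [/imsetP[u _ ->] xy]; exists u; rewrite // inE.
  by move=> [u]; rewrite inE => xy ->; rewrite imset_f ?inE.
rewrite card_imset // -(card_imset (f := fun u => (u.1, x - u.2, y - u.2))).
  2: by move=> [i g] [j h] [-> /addrI/oppr_inj->].
apply: eq_card => -[[i a] b]; rewrite inE /=; apply/imsetP/and3P.
  move=> [[j g]]; rewrite inE !in_translate => /andP[/= xD yD] [-> -> ->].
  by rewrite opprB addrA subrK xD yD eqxx.
move=> [aD bD /eqP ab]; exists (i, x - a).
  rewrite inE !in_translate /= subKr aD.
  rewrite (_ : y - (x - a) = b) //.
  by rewrite opprB addrCA -opprB -ab opprB addrC subrK.
rewrite /= subKr (_ : y - (x - a) = b) //.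
by rewrite opprB addrCA -opprB -ab opprB addrC subrK.
Qed.

End Translates.

(** * Spreads *)

(** The members of a spread are the lines through 0 of an affine translation
    plane of order q on G, and their cosets are all its lines. *)
Record spread (G : finZmodType) (I : finType) (q : nat) (L : I -> {set G}) :
    Prop := Spread {
  spread_card_index : #|I| = q.+1;
  spread_card_space : #|G| = (q ^ 2)%N;
  spread_card : forall i, #|L i| = q;
  spread0 : forall i, 0 \in L i;
  spreadB : forall i, {in L i &, forall x y, x - y \in L i};
  spread_meet : forall i j x, i != j -> x \in L i -> x \in L j -> x = 0;
  spread_cover : forall x, exists i, x \in L i }.

Section Spread.
Variables (G : finZmodType) (I : finType) (q : nat) (L : I -> {set G}).
Hypotheses (q_ge3 : (2 < q)%N) (spL : spread q L).

Let L0 i : 0 \in L i. Proof. exact: spread0 spL i. Qed.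
Let LB i x y : x \in L i -> y \in L i -> x - y \in L i.
Proof. exact: (spreadB spL). Qed.
Let LN i x : (- x \in L i) = (x \in L i).
Proof.
suff {x} imp x : x \in L i -> - x \in L i.
  by apply/idP/idP => /imp //; rewrite opprK.
by move=> xL; rewrite -sub0r LB.
Qed.
Let LD i x y : x \in L i -> y \in L i -> x + y \in L i.
Proof. by move=> xL yL; rewrite -[y]opprK LB // LN. Qed.
Let LBC i x y : (x - y \in L i) = (y - x \in L i).
Proof. by rewrite -LN opprB. Qed.
Let LT i y x z : x - y \in L i -> y - z \in L i -> x - z \in L i.
Proof. by move=> xyL yzL; rewrite -(subrK y x) -addrA LD. Qed.

Definition punctured i := L i :\ 0.

Lemma in_punctured i x : (x \in punctured i) = (x != 0) && (x \in L i).
Proof. by rewrite in_setD1. Qed.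

Lemma card_punctured i : #|punctured i| = (q - 1)%N.
Proof.
by have := cardsD1 0 (L i); rewrite L0 (spread_card spL) => ->; rewrite addKn.
Qed.

Lemma card_punctured_shift i d : d != 0 -> d \in L i ->
  #|punctured i :\ d| = (q - 2)%N.
Proof.
move=> d0 dL; have := cardsD1 d (punctured i).
by rewrite card_punctured in_punctured d0 dL -[2%N]/(1 + 1)%N subnDA => ->;
  rewrite addKn.
Qed.

(** Closure under subtraction forces both members of a difference d into the
    component L j of d; then y determines x = y + d, and y ranges over L j
    without 0 and - d. *)
Lemma spread_ddf : disjoint_difference_family punctured (q ^ 2) (q - 1) (q - 2).
Proof.
split=> [||i j neq_ij|d d0].
- exact: spread_card_space spL.
- exact: card_punctured.
- rewrite -setI_eq0; apply/eqP/setP=> x; rewrite in_setI !in_punctured in_set0.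
  apply/negP=> /andP[/andP[x0 xi] /andP[_ xj]].
  by rewrite (spread_meet spL neq_ij xi xj) eqxx in x0.
have [j dj] := spread_cover spL d.
have dNj : - d \in L j by rewrite LN.
have dN0 : - d != 0 by rewrite oppr_eq0.
rewrite -(card_punctured_shift dN0 dNj).
rewrite -(card_imset (f := fun y => (j, y + d, y))); last by move=> x y [].
apply: eq_card => -[[i x] y]; rewrite inE /= !in_punctured; apply/idP/imsetP.
  case/and3P=> /andP[x0 xi] /andP[y0 yi] /eqP xyd.
  have eij : i = j.
    apply/eqP/negPn/negP => neq_ij; case/negP: d0; apply/eqP.
    by apply: (spread_meet spL neq_ij) => //; rewrite -xyd LB.
  subst i; exists y; last by rewrite -xyd addrC subrK.
  by rewrite in_setD1 in_punctured y0 yi !andbT -addr_eq0 -xyd addrC subrK.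
move=> [z]; rewrite in_setD1 in_punctured => /and3P[zd z0 zj] [-> -> ->].
by rewrite addr_eq0 zd LD //= z0 zj addrC addKr eqxx.
Qed.

(** Two distinct components are complementary: subtraction is injective on
    their product, which has as many elements as the group. Geometrically,
    non-parallel lines meet. *)
Lemma spread_sub i j d : i != j ->
  exists a b, [/\ a \in L i, b \in L j & a - b = d].
Proof.
move=> neq_ij; pose f (u : G * G) := u.1 - u.2.
have inj_f : {in setX (L i) (L j) &, injective f}.
  move=> [a b] [a' b']; rewrite !in_setX => /andP[/= ai bj] /andP[/= a'i b'j].
  rewrite /f /= => eqf.
  have e : a - a' = b - b'.
    by rewrite -[a](subrK b) eqf addrAC [a' - b' - a']addrAC subrr add0r addrC.
  have a0 : a - a' = 0.
    by apply: (spread_meet spL neq_ij); [|rewrite e]; apply: LB.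
  by congr (_, _); apply/eqP; rewrite -subr_eq0 ?a0 // -e a0.
have : f @: setX (L i) (L j) == setT.
  rewrite eqEcard subsetT cardsT card_in_imset // cardsX !(spread_card spL).
  by rewrite (spread_card_space spL) mulnn leqnn.
move/eqP/setP/(_ d); rewrite inE => /imsetP[[a b]].
by rewrite in_setX => /andP[ai bj] ->; exists a, b.
Qed.

(** The two blocks lie on the parallel lines g + L i and h + L i. When these
    coincide, the common points are those of the line other than g and h. *)
Lemma card_meet_same i g h : g != h ->
  #|translate punctured (i, g) :&: translate punctured (i, h)|
    = (((g - h)%R \in L i) * (q - 2))%N.
Proof.
move=> neq_gh; have [ghL|ghL] := boolP (g - h \in L i); last first.
  apply/eqP; rewrite cards_eq0; apply/eqP/setP=> x.
  rewrite in_setI in_set0 !in_translate /= !in_punctured.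
  apply: contraNF ghL => /andP[/andP[_ xg] /andP[_ xh]].
  by rewrite (LT (y := x)) // LBC.
have hgL : h - g \in L i by rewrite LBC.
rewrite mul1n -(card_punctured_shift _ hgL) ?subr_eq0 1?eq_sym //.
rewrite -[RHS](card_imset _ (addIr g)).
apply: eq_card => x; rewrite in_setI !in_translate /= !in_punctured !subr_eq0.
have -> : (x - h \in L i) = (x - g \in L i).
  apply/idP/idP => xL.
    exact: LT xL hgL.
  exact: LT xL ghL.
apply/idP/imsetP => [/andP[/andP[xg xL] /andP[xh _]]|[y]].
  exists (x - g); last by rewrite subrK.
  by rewrite in_setD1 in_punctured subr_eq0 xg xL (inj_eq (addIr _)) xh.
rewrite in_setD1 in_punctured => /and3P[yh y0 yL] ->.
by rewrite addrK yL -subr_eq0 addrK y0 [_ == h]eq_sym -subr_eq eq_sym yh.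
Qed.

(** The lines g + L i and h + L j meet in a single point x; it is a common
    point of the blocks unless it is one of the removed points g and h. *)
Lemma card_meet_diff i j g h : i != j ->
  #|translate punctured (i, g) :&: translate punctured (j, h)|
    = (g - h \notin L i) && (g - h \notin L j).
Proof.
move=> neq_ij; have [a [b [ai bj ab]]] := spread_sub (h - g) neq_ij.
pose x := a + g.
have xb : x = b + h.
  by rewrite /x -(subrK b a) ab addrAC subrK addrC.
have xi : x - g \in L i by rewrite /x addrK.
have xj : x - h \in L j by rewrite xb addrK.
have xgE : (x == g) = (g - h \in L j).
  apply/eqP/idP=> [<- //|gh]; apply/eqP; rewrite -subr_eq0; apply/eqP.
  apply: (spread_meet spL neq_ij) => //.
  by apply: LT xj _; rewrite LBC.
have xhE : (x == h) = (g - h \in L i).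
  rewrite LBC; apply/eqP/idP=> [<- //|gh].
  apply/eqP; rewrite -subr_eq0; apply/eqP.
  apply: (spread_meet spL neq_ij) => //.
  by apply: LT xi _; rewrite LBC.
have xU y : y - g \in L i -> y - h \in L j -> y = x.
  move=> yi yj; apply/eqP; rewrite -subr_eq0; apply/eqP.
  apply: (spread_meet spL neq_ij).
    by apply: LT yi _; rewrite LBC.
  by apply: LT yj _; rewrite LBC.
rewrite -xgE -xhE andbC; have [/andP[xg xh]|xgh] := boolP (_ && _).
  apply/eqP/cards1P; exists x; apply/setP=> y.
  rewrite in_setI in_set1 !in_translate /= !in_punctured !subr_eq0.
  apply/idP/eqP => [/andP[/andP[_ yi] /andP[_ yj]]|->]; first exact: xU.
  by rewrite xg xi xh xj.
apply/eqP; rewrite cards_eq0; apply/eqP/setP=> y.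
rewrite in_setI in_set0 !in_translate /= !in_punctured !subr_eq0.
apply: contraNF xgh => /andP[/andP[yg yi] /andP[yh yj]].
by rewrite -(xU y yi yj) yg yh.
Qed.

(** If two distinct index pairs gave the same block, it would meet itself in
    q - 1 points, whereas [card_meet_same] and [card_meet_diff] only allow
    q - 2, 1 or 0 points, and q - 1 > 1. *)
Lemma translate_punctured_inj : injective (translate punctured).
Proof.
move=> [i g] [j h] eq_tr.
have card_tr :
    #|translate punctured (i, g) :&: translate punctured (j, h)| = (q - 1)%N.
  rewrite -eq_tr setIid card_imset ?card_punctured //; exact: addIr.
have [eq_ij|neq_ij] := eqVneq i j; last first.
  by move: card_tr; rewrite card_meet_diff //; case: (_ && _) => /=; lia.
subst j; have [-> //|neq_gh] := eqVneq g h.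
by move: card_tr; rewrite card_meet_same //; case: (_ \in _); lia.
Qed.

Lemma spread_two_design : two_design (dev punctured) (q ^ 2) (q - 1) (q - 2).
Proof. exact: ddf_two_design translate_punctured_inj spread_ddf. Qed.

Definition meets_in N (u v : I * G) :=
  (u != v) && (#|translate punctured u :&: translate punctured v| == N).

Lemma sum_meets_same N i h :
  (\sum_g meets_in N (i, g) (i, h)
    = (N == q - 2) * (q - 1) + (N == 0) * (q ^ 2 - q))%N.
Proof.
rewrite (reindex_inj (addIr h)) /=.
rewrite (bigID [in L i]) /=; congr addn.
  rewrite (bigD1 0) //= /meets_in add0r eqxx add0n.
  rewrite (eq_bigr (fun _ => (N == q - 2)%N : nat)) => [|d /andP[dL d0]].
    rewrite sum_nat_const mulnC -(card_punctured i); congr muln.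
    by apply: eq_card => d; rewrite in_punctured andbC.
  have dh : d + h != h by rewrite -subr_eq0 addrK.
  by rewrite card_meet_same // addrK dL mul1n xpair_eqE eqxx (negPf dh) eq_sym.
rewrite (eq_bigr (fun _ => (N == 0)%N : nat)) => [|d dL].
  rewrite sum_nat_const mulnC -(spread_card_space spL) -(spread_card spL i).
  by rewrite -(cardC [in L i]) addKn.
have dh : d + h != h.
  by rewrite -subr_eq0 addrK; apply: contraNneq dL => ->.
rewrite /meets_in card_meet_same // addrK (negPf dL).
by rewrite xpair_eqE eqxx (negPf dh) eq_sym.
Qed.

Lemma sum_meets_diff N i j h : i != j ->
  (\sum_g meets_in N (i, g) (j, h)
    = (N == 1) * (q - 1) ^ 2 + (N == 0) * (2 * q - 1))%N.
Proof.
move=> neq_ij; rewrite (reindex_inj (addIr h)) /=.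
have cardU : #|L i :|: L j| = (2 * q - 1)%N.
  have -> : #|L i :|: L j| = (q + q - #|[set 0%R : G]|)%N.
    rewrite cardsU !(spread_card spL); congr (_ - #|pred_of_set _|)%N.
    apply/setP=> x; rewrite in_setI in_set1.
    apply/andP/eqP => [[xi xj]|->]; last by rewrite !L0.
    exact: (spread_meet spL neq_ij xi xj).
  by rewrite cards1 mul2n addnn.
rewrite (bigID [in ~: (L i :|: L j)]) /=; congr addn.
  rewrite (eq_bigr (fun _ => (N == 1)%N : nat)) => [|d].
    rewrite sum_nat_const mulnC; congr muln.
    by rewrite cardsCs setCK cardU (spread_card_space spL); nia.
  rewrite !inE negb_or /meets_in xpair_eqE (negPf neq_ij) /= card_meet_diff //.
  rewrite addrK.
  by move=> ->; rewrite eq_sym.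
rewrite (eq_bigr (fun _ => (N == 0)%N : nat)) => [|d].
  rewrite sum_nat_const mulnC -cardU; congr muln.
  by apply: eq_card => d; rewrite unfold_in in_setC negbK.
rewrite !inE negbK /meets_in xpair_eqE (negPf neq_ij) /= card_meet_diff //.
by rewrite addrK -negb_or => ->; rewrite eq_sym.
Qed.

(** The factor q ^ 2 * (q + 1) counts the second block (j, h). For the first
    one, the index i is either j or one of the q others, and its base point
    runs over the whole group. *)
Lemma multiplicity_spread N :
  ((multiplicity (dev punctured) N).*2
    = q ^ 2 * (q + 1) * ((N == q - 2) * (q - 1) + (N == 0) * (q ^ 2 - q)
        + q * ((N == 1) * (q - 1) ^ 2 + (N == 0) * (2 * q - 1))))%N.
Proof.
rewrite -card_unordered_pairs; first last.
- by move=> X; rewrite eqxx.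
- by move=> X Y; rewrite eq_sym setIC.
pose tr2 (w : (I * G) * (I * G)) :=
  (translate punctured w.1, translate punctured w.2).
have inj_tr2 : injective tr2.
  move=> [u v] [u' v'].
  by move=> [/translate_punctured_inj-> /translate_punctured_inj->].
rewrite (_ : [set _ | _] = tr2 @: [set w | meets_in N w.1 w.2]); last first.
  apply/setP=> -[X Y]; rewrite inE dev_translate /=; apply/and3P/imsetP.
    move=> [/imsetP[u _ ->] /imsetP[v _ ->]].
    rewrite (inj_eq translate_punctured_inj) => uv.
    by exists (u, v); rewrite // inE.
  move=> [[u v]]; rewrite inE /= => uv [-> ->].
  by rewrite !imset_f // (inj_eq translate_punctured_inj).
rewrite card_imset // -sum1dep_card big_mkcond /=.
rewrite -(pair_bigA _ (fun u v => if meets_in N u v then 1 else 0)%N) /=.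
rewrite exchange_big /=.
rewrite (eq_bigr (fun _ => (q - 1) * (N == q - 2) + (N == 0) * (q ^ 2 - q)
   + q * ((N == 1) * (q - 1) ^ 2 + (N == 0) * (2 * q - 1))))%N => [|[j h] _].
  rewrite sum_nat_const cardT -cardE card_prod (spread_card_index spL).
  by rewrite (spread_card_space spL); ring.
rewrite -(pair_bigA _
  (fun i g => if meets_in N (i, g) (j, h) then 1 else 0)%N) /=.
rewrite (bigD1 j) //= sum_meets_same mulnC; congr addn.
rewrite (eq_bigr _ (fun i neq_ij => sum_meets_diff N h neq_ij)).
rewrite sum_nat_const; congr muln.
have := cardC1 j; rewrite (spread_card_index spL) /= => <-.
by apply: eq_card.
Qed.

End Spread.

Lemma spread_intersection_table (G : finZmodType) (I : finType) (q : nat)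
    (L : I -> {set G}) (Q := q%:R : rat) : (2 < q)%N -> spread q L ->
  has_intersection_table (dev (punctured L))
    [:: (0%N, 1 / 2 * (3 * Q ^+ 5 + Q ^+ 4 - 2 * Q ^+ 3));
        (1%N, 1 / 2 * (Q ^+ 6 - Q ^+ 5 - Q ^+ 4 + Q ^+ 3));
        ((q - 2)%N, 1 / 2 * (Q ^+ 4 - Q ^+ 2))].
Proof.
move=> q_ge3 spL; have mE := multiplicity_spread q_ge3 spL.
have q2_gt : (q < q ^ 2)%N by nia.
split=> N.
  rewrite block_intersection_number_gt0 -double_gt0 mE !inE.
  rewrite (eq_sym N 0%N) (eq_sym N 1%N) (eq_sym N (q - 2)%N).
  split.
    case: (0%N == N); case: (1%N == N); case: ((q - 2)%N == N) => //.
    by rewrite !mul0n !muln0.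
  move=> N_in; rewrite muln_gt0; apply/andP; split; first by nia.
  case/or3P: N_in => ->; rewrite mul1n.
  - by rewrite !addn_gt0 subn_gt0 q2_gt orbT.
  - rewrite !(addn_gt0, muln_gt0, expn_gt0, subn_gt0).
    by apply/orP; right; apply/andP; split; lia.
  - by rewrite !addn_gt0 subn_gt0 (ltnW q_ge3).
set m := multiplicity _ N in mE *.
have : m%:R * 2 = m.*2%:R :> rat by rewrite -muln2 natrM.
rewrite mE !(natrM, natrD, natrX, natrB) //; try by [lia | nia].
move=> mR; apply: (@mulIf _ 2) => //; rewrite mR -/Q !big_cons big_nil /=.
rewrite (eq_sym N 0%N) (eq_sym N 1%N) (eq_sym N (q - 2)%N).
by case: (0%N == N); case: (1%N == N); case: ((q - 2)%N == N) => /=; field.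
Qed.

(** * Cyclotomic classes *)

Section Cyclotomic.
Variables (F : finFieldType) (q : nat) (alpha : {unit F}).
Hypotheses (q_gt1 : (1 < q)%N) (cardF : #|F| = (q ^ 2)%N).
Hypothesis gen_alpha : generator [set: {unit F}] alpha.

Let a : F := val alpha.

Lemma expr_alpha n : a ^+ n = val (alpha ^+ n)%g.
Proof. by rewrite FinRing.val_unitX. Qed.

Lemma alpha_neq0 : a != 0.
Proof. by rewrite -unitfE (valP alpha). Qed.

Lemma eq_expr_alpha m n : (a ^+ m == a ^+ n) = (m == n %[mod q ^ 2 - 1]).
Proof.
rewrite !expr_alpha (inj_eq val_inj) eq_expg_mod_order.
by rewrite orderE -(eqP gen_alpha) card_finField_unit cardF subn1.
Qed.

Lemma unit_alpha x : x != 0 -> exists n, x = a ^+ n.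
Proof.
move=> x0; have ux : x \is a GRing.unit by rewrite unitfE.
have : FinRing.unit F ux \in [set: {unit F}] by rewrite inE.
rewrite (eqP gen_alpha) => /cycleP[n xn]; exists n.
by rewrite expr_alpha -xn.
Qed.

(** With x = alpha ^ t, the equation says that q ^ 2 - 1 = (q + 1) (q - 1)
    divides (t - i) (q - 1), i.e. that q + 1 divides t - i. *)
Lemma in_cyclotomic_class (i : nat) x :
  (x \in cyclotomic_class alpha (q + 1) i)
    = (x != 0) && (x ^+ (q - 1) == a ^+ (i * (q - 1))).
Proof.
have q2E : (q ^ 2 - 1 = (q + 1) * (q - 1))%N by nia.
rewrite inE; apply/asboolP/andP.
  move=> [t ti ->]; rewrite expfz_neq0 ?alpha_neq0 //; split=> //.
  have /dvdzP[s ts] : ((q + 1)%N%:Z %| t - i%:Z)%Z.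
    by rewrite -eqz_mod_dvd; apply/eqP.
  have -> : t = i%:Z + (q + 1)%N%:Z * s by rewrite mulrC -ts addrC subrK.
  rewrite exprnP exprz_exp.
  rewrite mulrDl expfzDr ?alpha_neq0 // -PoszM -exprnP mulrAC -PoszM -q2E.
  rewrite -exprz_exp -exprnP.
  have /eqP-> : a ^+ (q ^ 2 - 1) == a ^+ 0 by rewrite eq_expr_alpha modnn mod0n.
  by rewrite expr0 exp1rz mulr1.
move=> [/unit_alpha[n ->]]; rewrite -exprM eq_expr_alpha q2E -!muln_modl.
rewrite eqn_pmul2r ?subn_gt0 // => /eqP ni; exists n%:Z => //.
by rewrite !modz_nat ni.
Qed.

(** The K-line through alpha ^ i: the equation says that x / alpha ^ i is fixed
    by the Frobenius map x |-> x ^ q. In this form the line is visibly an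
    additive group. *)
Definition component (i : nat) : {set F} :=
  [set x | x ^+ q == a ^+ (i * (q - 1)) * x].

Lemma punctured_component (i : nat) :
  cyclotomic_class alpha (q + 1) i = component i :\ 0.
Proof.
apply/setP=> x; rewrite in_cyclotomic_class in_setD1 inE.
have [//|x0] := eqVneq x 0; rewrite /=.
rewrite -[X in _ = (x ^+ X == _)](subnK (ltnW q_gt1)) addn1 exprSr.
by rewrite (inj_eq (mulIf x0)).
Qed.

Lemma class_cover x : x != 0 ->
  exists i : 'I_(q + 1), forall j : 'I_(q + 1),
    (x \in cyclotomic_class alpha (q + 1) j) = (j == i).
Proof.
move=> x0; have [n ->] := unit_alpha x0.
have n_lt : (n %% (q + 1) < q + 1)%N by rewrite ltn_mod addn1.
have q2E : (q ^ 2 - 1 = (q + 1) * (q - 1))%N by nia.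
exists (Ordinal n_lt) => j.
rewrite in_cyclotomic_class expf_neq0 ?alpha_neq0 //= -exprM eq_expr_alpha q2E.
rewrite -!muln_modl eqn_pmul2r ?subn_gt0 // -val_eqE /=.
by rewrite [(j %% _)%N]modn_small // eq_sym.
Qed.

(** Multiplication by alpha ^ k maps the class of 0 onto the class of k, so the
    q + 1 classes have the same size; they partition q ^ 2 - 1 elements. *)
Lemma card_class (i : nat) : #|cyclotomic_class alpha (q + 1) i| = (q - 1)%N.
Proof.
pose D k := cyclotomic_class alpha (q + 1) k; rewrite -/(D i).
have card0 k : #|D k| = #|D 0%N|.
  have ak0 : a ^+ k != 0 by rewrite expf_neq0 ?alpha_neq0.
  rewrite -[RHS](card_imset _ (mulfI ak0)); apply: eq_card => x.
  rewrite in_cyclotomic_class; apply/andP/imsetP => [[x0 /eqP xk]|[y]].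
    exists (x / a ^+ k); last by rewrite mulrC divfK.
    rewrite in_cyclotomic_class mulf_neq0 ?invr_eq0 //= exprMn exprVn xk.
    by rewrite -exprM divff ?expf_neq0 ?alpha_neq0.
  rewrite in_cyclotomic_class => /andP[y0 /eqP yk] ->.
  by rewrite mulf_neq0 //= exprMn yk mul0n mulr1 exprM.
have : (\sum_(x : F) \sum_(j < q + 1) (x \in D j) = (q + 1) * #|D i|)%N.
  rewrite exchange_big /= (eq_bigr (fun _ => #|D i|)) => [|j _].
    by rewrite sum_nat_const card_ord.
  by rewrite card0 -(card0 j) -sum1_card [RHS]big_mkcond.
rewrite (bigD1 0) //= big1 => [|j _]; last by rewrite in_cyclotomic_class eqxx.
rewrite (eq_bigr (fun _ => 1%N)) => [|x /class_cover[j xj]].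
  by rewrite sum1_card cardC1 cardF; nia.
by rewrite (bigD1 j) //= xj eqxx big1 // => k; rewrite xj => /negPf->.
Qed.

Hypothesis pcharq : [pchar F].-nat q.

(** Because q is a power of the characteristic, x |-> x ^ q is additive, so the
    components are subgroups; the rest is that the classes partition the nonzero
    elements. *)
Lemma cyclotomic_spread : spread q (fun i : 'I_(q + 1) => component i).
Proof.
have comp0 i : 0 \in component i by rewrite inE expr0n mulr0 -leqn0 leqNgt ltnW.
split=> //.
- by rewrite card_ord addn1.
- move=> i; rewrite (cardsD1 0) comp0 -punctured_component card_class; lia.
- move=> i x y; rewrite !inE => /eqP xi /eqP yi.
  by rewrite exprDn_pchar // exprNn_pchar // xi yi mulrBr.
- move=> i j x neq_ij xi xj; apply/eqP; apply: contraNT neq_ij => x0.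
  have [k xk] := class_cover x0.
  have := xk i; have := xk j.
  rewrite !punctured_component !in_setD1 x0 xi xj /=.
  by move=> /esym/eqP-> /esym/eqP->.
- move=> x; have [->|x0] := eqVneq x 0; last first.
    have [i xi] := class_cover x0; exists i.
    by have := xi i; rewrite eqxx punctured_component in_setD1 x0.
  by exists (Ordinal (ltnW (ltn_addr 1 q_gt1))).
Qed.

End Cyclotomic.

Theorem corollary4p2 (p r : nat) (hp : prime p) (hr : (0 < r)%N)
    (hpr : (3 <= p ^ r)%N)
    (F : finFieldType) (hF : #|F| = (p ^ (2 * r))%N)
    (alpha : {unit F}) (halpha : generator [set: {unit F}] alpha) :
  let C := fun i : 'I_(p ^ r + 1) => cyclotomic_class alpha (p ^ r + 1) i in
  let P := fun e : nat => (p%:R : rat) ^+ e in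
  [/\ disjoint_difference_family C (p ^ (2 * r)) (p ^ r - 1) (p ^ r - 2),
      two_design (dev C) (p ^ (2 * r)) (p ^ r - 1) (p ^ r - 2)
    & has_intersection_table (dev C)
        [:: (0%N, 1 / 2 * (3 * P (5 * r)%N + P (4 * r)%N - 2 * P (3 * r)%N));
            (1%N, 1 / 2 * (P (6 * r)%N - P (5 * r)%N - P (4 * r)%N
                           + P (3 * r)%N));
            ((p ^ r - 2)%N, 1 / 2 * (P (4 * r)%N - P (2 * r)%N))]].
Proof.
move=> C P; have PE k : P (k * r)%N = (p ^ r)%N%:R ^+ k.
  by rewrite /P natrX -exprM mulnC.
rewrite !{}PE mulnC expnM; rewrite mulnC expnM in hF.
have pcharq : [pchar F].-nat (p ^ r)%N.
  rewrite pnatX; apply/orP; left.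
  apply/pnatP=> [|l l_pr]; first exact: prime_gt0.
  rewrite dvdn_prime2 // => /eqP->.
  by apply: (card_finPcharP (n := (r * 2))); rewrite // expnM.
have spC := cyclotomic_spread (ltnW hpr) hF halpha pcharq.
have -> : C = punctured (fun i : 'I_(p ^ r + 1) => component (p ^ r) alpha i).
  by apply/funext=> i; exact: (punctured_component (ltnW hpr) hF halpha).
split; first exact: spread_ddf.
  exact: spread_two_design.
exact: spread_intersection_table.
Qed.
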